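(* Let $\Phi$ be an approximation of the penalty term $\phi$, let $g_{\lambda}(x) = f(x) + \lambda\phi(x)$ and $F_{\lambda}(x,p) = f(x) + \lambda \Phi(x,p)$, and put $e(p) = \sup_{x \in A} |\Phi(x, p) - \phi(x)|$ for $p \in P$. Suppose that $g_{\lambda_0}$ is bounded below on $A$ for some $\lambda_0 \ge 0$. Let a sequence $\{ p_n \} \subset P$ converge to $p_0$, and let $\{ \lambda_n \} \subset (\lambda_0, + \infty)$ be an increasing unbounded sequence such that $\lambda_n e(p_n) \to 0$ as $n \to \infty$. Suppose, finally, that a sequence $\{ x_n \} \subset A$ satisfies $$F_{\lambda_n}(x_n, p_n) \le \inf_{x \in A} F_{\lambda_n}(x, p_n) + \varepsilon$$ for any sufficiently large $n \in \mathbb{N}$ and for some $\varepsilon > 0$. Then $\phi(x_n) \to 0$ as $n \to \infty$. Moreover, if the functions $f$ and $\phi$ are l.s.c. on $A$, and the set $A$ is closed, then any cluster point $x^*$ of the sequence $\{ x_n \}$ is a feasible point of the problem $(\mathcal{P})$, and $f^* \le f(x^* ) \le f^* + \varepsilon$.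
   Context: Setting. $X$ is a metric space, $M, A \subset X$ are nonempty, $f \colon X \to \mathbb{R} \cup \{+\infty\}$. The problem $(\mathcal{P})$ is: minimize $f(x)$ subject to $x \in M$, $x \in A$. $\Omega = M \cap A$ is the set of feasible points; it is assumed that $f$ attains a global minimum on $\Omega$, with finite value $f^*$. $\phi \colon X \to [0,+\infty]$ satisfies $\phi(x) = 0$ iff $x \in M$. $P$ is a metric space and $p_0 \in P$ is fixed. Approximation: a function $\Phi \colon X \times P \to [0,+\infty]$ is an approximation of $\phi$ if $\Phi(\cdot, p_0) = \phi(\cdot)$ and $\Phi(\cdot, p) \to \phi(\cdot)$ as $p \to p_0$ uniformly on $A$. With the convention that $|\Phi(x,p) - \phi(x)| = 0$ when both values are $+\infty$ (and $= +\infty$ when exactly one is), uniform convergence means $e(p) \to 0$ as $p \to p_0$. ''L.s.c. on a set'' means lower semicontinuous at every point of that set. *)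

(* Defs.v *)
From HB Require Import structures.
From mathcomp Require Import all_boot all_order all_algebra.
From mathcomp Require Import all_classical all_reals all_analysis.

Set Implicit Arguments.
Unset Strict Implicit.
Unset Printing Implicit Defensive.

Import Order.TTheory GRing.Theory Num.Theory.
Import numFieldNormedType.Exports.

Local Open Scope classical_set_scope.
Local Open Scope ring_scope.
Local Open Scope ereal_scope.

(* [|u - v|] on [0, +oo] with the convention that it is 0 when u = v = +oo;
   the library's +oo - +oo is -oo, whose absolute value would be +oo. *)
Definition ereal_gap (R : realType) (u v : \bar R) : \bar R :=
  if (u == +oo) && (v == +oo) then 0 else `|u - v|.

Definition unif_err (R : realType) (X P : Type) (A : set X)
    (phi : X -> \bar R) (Phi : X -> P -> \bar R) (p : P) : \bar R :=
  ereal_sup [set ereal_gap (Phi x p) (phi x) | x in A].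

Definition is_penalty_term (R : realType) (X : Type) (M : set X)
    (phi : X -> \bar R) : Prop :=
  (forall x, 0 <= phi x) /\ (forall x, phi x = 0 <-> M x).

Definition is_approximation (R : realType) (X : Type) (P : metricType R)
    (p0 : P) (A : set X) (phi : X -> \bar R) (Phi : X -> P -> \bar R) : Prop :=
  [/\ forall x p, 0 <= Phi x p,
      forall x, Phi x p0 = phi x &
      unif_err A phi Phi p @[p --> p0] --> 0].

(* In the library's extended reals 0 * +oo = 0, so g_ f phi 0 is f. *)
Definition g_ (R : realType) (X : Type) (f phi : X -> \bar R)
    (lam : R) (x : X) : \bar R :=
  f x + lam%:E * phi x.

Definition F_ (R : realType) (X P : Type) (f : X -> \bar R)
    (Phi : X -> P -> \bar R) (lam : R) (x : X) (p : P) : \bar R :=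
  f x + lam%:E * Phi x p.

Definition bounded_below_on (R : realType) (X : Type) (A : set X)
    (h : X -> \bar R) : Prop :=
  exists c : R, forall x, A x -> c%:E <= h x.

Definition attained_min (R : realType) (X : Type) (D : set X)
    (h : X -> \bar R) (m : \bar R) : Prop :=
  (exists2 x, D x & h x = m) /\ (forall x, D x -> m <= h x).

(* Pointwise version of [lower_semicontinuous], required at the points of A
   only; the neighbourhoods are those of the whole space X. *)
Definition lsc_on (R : realType) (X : topologicalType) (A : set X)
    (h : X -> \bar R) : Prop :=
  forall x, A x -> forall a : R, a%:E < h x ->
    exists2 V, nbhs x V & forall y, V y -> a%:E < h y.

(* Main.v *)
(* Uniform closeness of Phi to phi turns the approximate minimality of x_n for
   F_{lambda_n}(., p_n), tested against a global minimizer of f on M `&` A, into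
   g_{lambda_n}(x_n) <= f^* + eps + 2 lambda_n e(p_n).  Subtracting the lower
   bound of g_{lambda_0} gives phi(x_n) = O(1 / (lambda_n - lambda_0)); dropping
   the penalty gives f(x_n) <= f^* + eps + o(1), and lower semicontinuity passes
   both estimates to the cluster points. *)

Require Import Defs.
From HB Require Import structures.
From mathcomp Require Import all_boot all_order all_algebra.
From mathcomp Require Import all_classical all_reals all_analysis.
From mathcomp Require Import lra.

Set Implicit Arguments.
Unset Strict Implicit.
Unset Printing Implicit Defensive.

Import Order.TTheory GRing.Theory Num.Theory.
Import numFieldNormedType.Exports.

Local Open Scope classical_set_scope.
Local Open Scope ring_scope.
Local Open Scope ereal_scope.

Lemma cvge_lt (R : realFieldType) (T : Type) (F : set_system T)
    {FF : Filter F} (h : T -> \bar R) (l b : \bar R) :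
  h t @[t --> F] --> l -> l < b -> \forall t \near F, h t < b.
Proof. by move=> hl lb; exact: (hl _ (open_ereal_lt' lb)). Qed.

Lemma ereal_gapC (R : realType) (u v : \bar R) : ereal_gap u v = ereal_gap v u.
Proof.
by rewrite /ereal_gap andbC; case: u v => [u| |] [v| |] //=; rewrite distrC.
Qed.

(** When exactly one value is [+oo], the gap is [+oo]; when both are, [v] alone dominates [u].
    Nonnegativity excludes [v = -oo], which would absorb the gap. *)
Lemma le_add_ereal_gap (R : realType) (u v : \bar R) :
  0 <= u -> 0 <= v -> u <= v + ereal_gap u v.
Proof.
rewrite /ereal_gap; case: u v => [u| |] [v| |] //= _ _; last first.
- by rewrite leey.
rewrite lee_fin -lerBlDl; exact: ler_norm.
Qed.

Lemma ereal_gap_le_unif_err (R : realType) (X P : Type) (A : set X)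
    (phi : X -> \bar R) (Phi : X -> P -> \bar R) (p : P) (y : X) :
  A y -> ereal_gap (Phi y p) (phi y) <= unif_err A phi Phi p.
Proof. by move=> Ay; apply: ereal_sup_ubound; exists y. Qed.

Lemma ereal_gap_ge0 (R : realType) (u v : \bar R) : 0 <= ereal_gap u v.
Proof. by rewrite /ereal_gap; case: ifP. Qed.

Lemma unif_err_ge0 (R : realType) (X P : Type) (A : set X)
    (phi : X -> \bar R) (Phi : X -> P -> \bar R) (p : P) :
  A !=set0 -> 0 <= unif_err A phi Phi p.
Proof.
move=> [y Ay]; apply: le_trans (ereal_gap_le_unif_err phi Phi p Ay).
exact: ereal_gap_ge0.
Qed.

(** Nonnegativity of [v] and [d] lets multiplication by [l] distribute over [v + d] even at infinite
    values. *)
Lemma le_penalized (R : realType) (a u v d : \bar R) (l : R) :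
  (0 <= l)%R -> 0 <= v -> 0 <= d -> u <= v + d ->
  a + l%:E * u <= a + l%:E * v + l%:E * d.
Proof.
move=> l0 v0 d0 uvd; rewrite -addeA -ge0_muleDr//.
by apply: leeD2l; apply: lee_wpmul2l.
Qed.

Section unif_err_penalized.
Context (R : realType) (X P : Type) (A : set X) (f phi : X -> \bar R).
Context (Phi : X -> P -> \bar R) (p : P) (l : R) (y : X).
Hypotheses (phi_ge0 : 0 <= phi y) (Phi_ge0 : 0 <= Phi y p).
Hypotheses (l_ge0 : (0 <= l)%R) (Ay : A y).

Let err_ge0 : 0 <= unif_err A phi Phi p.
Proof. by apply: unif_err_ge0; exists y. Qed.

Lemma g_le_F : g_ f phi l y <= F_ f Phi l y p + l%:E * unif_err A phi Phi p.
Proof.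
apply: le_penalized => //; apply: le_trans (le_add_ereal_gap phi_ge0 Phi_ge0) _.
by rewrite ereal_gapC; apply: leeD2l; exact: ereal_gap_le_unif_err.
Qed.

Lemma F_le_g : F_ f Phi l y p <= g_ f phi l y + l%:E * unif_err A phi Phi p.
Proof.
apply: le_penalized => //; apply: le_trans (le_add_ereal_gap Phi_ge0 phi_ge0) _.
by apply: leeD2l; exact: ereal_gap_le_unif_err.
Qed.

End unif_err_penalized.

(** The error is paid twice: once to pass from [g_] to [F_] at the approximate minimizer [x], once
    to return from [F_] to [g_] at the competitor [y]. *)
Lemma approx_minimizer_g_le (R : realType) (X P : Type) (A : set X)
    (f phi : X -> \bar R) (Phi : X -> P -> \bar R) (p : P) (l : R) (x y : X)
    (eps : \bar R) :
  (forall z, 0 <= phi z) -> (forall z, 0 <= Phi z p) -> (0 <= l)%R ->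
  A x -> A y ->
  F_ f Phi l x p <= ereal_inf [set F_ f Phi l z p | z in A] + eps ->
  g_ f phi l x <= g_ f phi l y + eps
    + (l%:E * unif_err A phi Phi p + l%:E * unif_err A phi Phi p).
Proof.
move=> phi0 Phi0 l0 Ax Ay Fx.
apply: le_trans (g_le_F f (phi0 x) (Phi0 x) l0 Ax) _.
rewrite addeA; apply: leeD2r; apply: le_trans Fx _.
rewrite addeAC; apply: leeD2r; apply: le_trans (F_le_g f (phi0 y) (Phi0 y) l0 Ay).
by apply: ereal_inf_lbound; exists y.
Qed.

(** For finite values, subtracting the two bounds leaves [(l - l0) * v <= b - c]. An infinite [v]
    would make [a + l%:E * v] equal to [+oo], since [l > 0] and [a] is not [-oo], against the real
    bound [b]. *)
Lemma penalty_le (R : realType) (a v : \bar R) (l0 l c b : R) :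
  a != -oo -> 0 <= v -> (0 <= l0)%R -> (l0 < l)%R ->
  c%:E <= a + l0%:E * v -> a + l%:E * v <= b%:E ->
  v <= ((b - c) / (l - l0))%:E.
Proof.
move=> aNy v0 l00 l0l.
have l_gt0 : (0 < l)%R by exact: le_lt_trans l0l.
case: v v0 => [v| |] // v0; last first.
  by move=> _; case: a aNy => [a| |] // _; rewrite gt0_muley ?lte_fin.
case: a aNy => [a| |] // _; rewrite -!EFinM -!EFinD !lee_fin => ca ab.
by rewrite ler_pdivlMr ?subr_gt0//; lra.
Qed.

(** If [h z] exceeded [b + d], semicontinuity would keep [h] above that level near [z], where the
    sequence returns infinitely often, against the eventual bound. *)
Lemma le_of_lsc_cluster (R : realType) (X : topologicalType) (A : set X)
    (h : X -> \bar R) (x : nat -> X) (z : X) (b : \bar R) :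
  lsc_on A h -> A z -> cluster (x n @[n --> \oo]) z ->
  (forall d : R, (0 < d)%R -> \forall n \near \oo, h (x n) <= b + d%:E) ->
  h z <= b.
Proof.
move=> hlsc Az xz hb; apply/lee_addgt0Pr => d d0; rewrite leNgt; apply/negP.
have := hb _ d0; case: (b + d%:E) => [r| |] hr rz.
- have [V Vz hV] := hlsc _ Az _ rz.
  have [y [/= hy /hV]] := xz [set y | h y <= r%:E] V hr Vz.
  by rewrite ltNge hy.
- by rewrite ltNge leey in rz.
(* Here [b + d] is [-oo], not a real level to which semicontinuity applies; any real level below
   [h z] serves instead. *)
- have [r rz'] : exists r : R, r%:E < h z.
    case: (h z) rz => [s| |] // _; last by exists 0%R; rewrite ltry.
    by exists (s - 1)%R; rewrite lte_fin; lra.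
  have [V Vz hV] := hlsc _ Az _ rz'.
  have [y [/= hy /hV]] := xz [set y | h y <= -oo] V hr Vz.
  by move/lt_le_trans => /(_ _ hy).
Qed.

Theorem proposition5p4 (R : realType) (X P : metricType R) (M A : set X)
    (f phi : X -> \bar R) (fstar : R) (p0 : P) (Phi : X -> P -> \bar R)
    (lam0 : R) (p : nat -> P) (lam : nat -> R) (x : nat -> X) (eps : R)
    (M_neq0 : M !=set0) (A_neq0 : A !=set0)
    (f_neqNy : forall y, f y != -oo)
    (f_min : attained_min (M `&` A) f fstar%:E)
    (phi_pen : is_penalty_term M phi)
    (Phi_approx : is_approximation p0 A phi Phi)
    (lam0_ge0 : (0 <= lam0)%R)
    (g_bounded : bounded_below_on A (g_ f phi lam0))
    (p_cvg : p n @[n --> \oo] --> p0)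
    (lam_gt : forall n, (lam0 < lam n)%R)
    (lam_incr : increasing_seq lam)
    (lam_unbounded : ~ has_ubound (range lam))
    (lam_err : (lam n)%:E * unif_err A phi Phi (p n) @[n --> \oo] --> 0)
    (x_in_A : forall n, A (x n))
    (eps_gt0 : (0 < eps)%R)
    (x_min : \forall n \near \oo,
      F_ f Phi (lam n) (x n) (p n) <=
        ereal_inf [set F_ f Phi (lam n) y (p n) | y in A] + eps%:E) :
  phi (x n) @[n --> \oo] --> 0 /\
  (lsc_on A f -> lsc_on A phi -> closed A ->
   forall xstar : X, cluster (x n @[n --> \oo]) xstar ->
     (M `&` A) xstar /\ fstar%:E <= f xstar <= fstar%:E + eps%:E).
Proof.
have [[y0 [My0 Ay0] fy0] fmin] := f_min.
have [phi0 phiM] := phi_pen.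
have [Phi0 _ _] := Phi_approx.
have lamlam0 n : (0 <= lam n)%R by apply: ltW; exact: le_lt_trans (lam_gt n).
have g_le d : (0 < d)%R ->
    \forall n \near \oo, g_ f phi (lam n) (x n) <= (fstar + eps + d)%:E.
  move=> d0.
  (* Half of [d] for each of the two error terms. *)
  have err_le : \forall n \near \oo,
      (lam n)%:E * unif_err A phi Phi (p n) < (d / 2)%:E.
    by apply: (cvge_lt lam_err); rewrite lte_fin divr_gt0.
  near=> n.
  have xn : F_ f Phi (lam n) (x n) (p n) <=
      ereal_inf [set F_ f Phi (lam n) y (p n) | y in A] + eps%:E by near: n.
  have := approx_minimizer_g_le phi0 (Phi0^~ (p n)) (lamlam0 n) (x_in_A n) Ay0 xn.
  move/le_trans; apply.
  (* The competitor [y0] is feasible, so its penalty vanishes and [g_] takes the value [fstar]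
     there. *)
  rewrite /g_ fy0 (phiM y0).2// mule0 adde0 [leRHS]EFinD EFinD; apply: leeD2l.
  by rewrite [d]splitr EFinD; apply: leeD; apply: ltW; near: n.
have phi_cvg : phi (x n) @[n --> \oo] --> 0.
  have [c gc] := g_bounded.
  have lamoo : lam n @[n --> \oo] --> +oo%R.
    apply/cvgryPge => b.
    have [N bN] : exists N, (b < lam N)%R.
      apply: contrapT => nb; apply: lam_unbounded; exists b => _ [N _ <-].
      by rewrite leNgt; apply/negP => bN; apply: nb; exists N.
    near=> n; apply: le_trans (ltW bN) _; rewrite lam_incr.
    by near: n; exact: nbhs_infty_ge.
  (* Numerator of the bound from [penalty_le], with [g_le] taken at [d = 1]: a fixed slack suffices,
     as the denominator [lam n - lam0] diverges. *)
  pose C := (fstar + eps + 1 - c)%R.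
  have Ccvg : (C / (lam n - lam0))%:E @[n --> \oo] --> 0.
    apply: cvg_EFin; first by near=> n.
    rewrite -[0%R](mulr0 C); apply: cvgMr; apply/gtr0_cvgV0.
      by near=> n; rewrite subr_gt0.
    apply/cvgryPge => b; have /cvgryPge/(_ (b + lam0)%R) := lamoo.
    by apply: filterS => n; rewrite lerBrDr.
  apply: (squeeze_cvge _ (cvg_cst 0) Ccvg).
  near=> n; rewrite phi0/=.
  apply: (penalty_le (f_neqNy (x n))) => //; first exact: gc.
  by near: n; exact: g_le.
split=> // f_lsc phi_lsc Acl z xz.
have Az : A z.
  apply: Acl => V Vz.
  have xA : (x n @[n --> \oo]) A by exists 0%N => // n _; exact: x_in_A.
  by have [y [Ay Vy]] := xz A V xA Vz; exists y.
have Mz : M z.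
  apply/phiM/le_anti; rewrite phi0 andbT.
  apply: (le_of_lsc_cluster phi_lsc Az xz) => d d0; rewrite add0e.
  have d0' : 0 < d%:E by rewrite lte_fin.
  by apply: filterS (cvge_lt phi_cvg d0') => n /ltW.
(* Feasibility of [z] gives the lower bound; the upper one uses [f <= g_] along the sequence, the
   penalty being nonnegative. *)
split=> //; rewrite fmin//=.
apply: (le_of_lsc_cluster f_lsc Az xz) => d /g_le.
apply: filterS => n; rewrite -!EFinD; apply: le_trans.
by rewrite /g_ leeDl// mule_ge0// lee_fin.
Unshelve. all: by end_near. Qed.
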